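(* Let $(A,[-,-],\alpha)$ be a Hom-Malcev algebra, let $(V,\rho,\beta)$ be a representation of it, and let $T:V\to A$ be an $\mathcal O$-operator associated to $(V,\rho,\beta)$. Define $a\cdot b=\rho(T(a))b$ for all $a,b\in V$. Then: (1) $(V,\cdot,\beta)$ is a Hom-pre-Malcev algebra; hence $V$ carries the associated Hom-Malcev algebra structure with bracket $a\cdot b-b\cdot a$ and twisting map $\beta$, and $T$ is a homomorphism of Hom-Malcev algebras from it to $(A,[-,-],\alpha)$. (2) $T(V)=\{T(a)\mid a\in V\}\subset A$ is a Hom-Malcev subalgebra of $(A,[-,-],\alpha)$, and $T(a)\cdot T(b)=T(a\cdot b)$, for all $a,b\in V$, gives a (well-defined) Hom-pre-Malcev algebra structure $(T(V),\cdot,\alpha)$ on $T(V)$. (3) The Hom-Malcev algebra structure on $T(V)$ given by the commutator of the product in (2) is just the Hom-Malcev subalgebra structure inherited from $(A,[-,-],\alpha)$, and $T$ is a morphism of Hom-pre-Malcev algebras from $(V,\cdot,\beta)$ to $(T(V),\cdot,\alpha)$.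
   Context: All vector spaces are over a field $\mathbb K$ of characteristic $0$. A Hom-algebra $(A,\mu,\alpha)$ is a vector space $A$ with a bilinear map $\mu:A\times A\to A$ and a linear map $\alpha:A\to A$; all Hom-algebras are assumed multiplicative, i.e. $\alpha(\mu(x,y))=\mu(\alpha(x),\alpha(y))$. A morphism (homomorphism) of Hom-algebras $(A,\mu,\alpha)\to(A',\mu',\alpha')$ is a linear map $f$ with $f(\mu(x,y))=\mu'(f(x),f(y))$ and $f\circ\alpha=\alpha'\circ f$. A subalgebra is a subspace closed under the product and the twisting map. A Hom-Malcev algebra is a Hom-algebra $(A,[-,-],\alpha)$ with $[-,-]$ anti-symmetric and, for all $x,y,z\in A$, $J_\alpha(\alpha(x),\alpha(y),[x,z])=[J_\alpha(x,y,z),\alpha^2(x)]$, where $J_\alpha(x,y,z)=[[x,y],\alpha(z)]+[[y,z],\alpha(x)]+[[z,x],\alpha(y)]$. A representation of a Hom-Malcev algebra $(A,[-,-],\alpha)$ is a triple $(V,\rho,\beta)$ with $V$ a vector space, $\rho:A\to \mathrm{End}(V)$ linear, $\beta\in \mathrm{End}(V)$, such that for all $x,y,z\in A$: $\rho(\alpha(x))\beta=\beta\rho(x)$ and $$\rho([[x,y],\alpha(z)])\beta^2=\rho(\alpha^2(x))\rho(\alpha(y))\rho(z)-\rho(\alpha^2(z))\rho(\alpha(x))\rho(y)+\rho(\alpha^2(y))\rho([z,x])\beta-\rho(\alpha([y,z]))\rho(\alpha(x))\beta.$$ An $\mathcal O$-operator of $(A,[-,-],\alpha)$ associated to $(V,\rho,\beta)$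 is a linear map $T:V\to A$ with $\alpha\circ T=T\circ\beta$ and $[T(a),T(b)]=T(\rho(T(a))b-\rho(T(b))a)$ for all $a,b\in V$. A Hom-pre-Malcev algebra is a Hom-algebra $(A,\cdot,\alpha)$ such that, with $[x,y]=x\cdot y-y\cdot x$, for all $x,y,z,t\in A$: $$[\alpha(y),\alpha(z)]\cdot\alpha(x\cdot t)+[[x,y],\alpha(z)]\cdot\alpha^2(t)+\alpha^2(y)\cdot([x,z]\cdot\alpha(t))-\alpha^2(x)\cdot(\alpha(y)\cdot(z\cdot t))+\alpha^2(z)\cdot(\alpha(x)\cdot(y\cdot t))=0.$$ Its commutator bracket makes $(A,[-,-],\alpha)$ a Hom-Malcev algebra, called the associated Hom-Malcev algebra. *)

(* Defs.v *)
From HB Require Import structures.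
From mathcomp Require Import all_boot all_order all_algebra.
From mathcomp Require Import boolp classical_sets.

Set Implicit Arguments.
Unset Strict Implicit.
Unset Printing Implicit Defensive.

Import GRing.Theory.
Local Open Scope ring_scope.

Section HomAlgebras.
Variables (K : fieldType) (A : lmodType K).
Implicit Types (mu : {bilinear A -> A -> A}) (alpha : {linear A -> A}).

(* All Hom-algebras are multiplicative. *)
Definition hom_multiplicative mu alpha : Prop :=
  forall x y, alpha (mu x y) = mu (alpha x) (alpha y).

Definition hom_jacobian mu alpha (x y z : A) : A :=
  mu (mu x y) (alpha z) + mu (mu y z) (alpha x) + mu (mu z x) (alpha y).

Record hom_malcev mu alpha : Prop := HomMalcev {
  hom_malcev_mult : hom_multiplicative mu alpha;
  hom_malcev_anti : forall x y, mu x y = - mu y x;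
  hom_malcev_id : forall x y z,
    hom_jacobian mu alpha (alpha x) (alpha y) (mu x z)
    = mu (hom_jacobian mu alpha x y z) (alpha (alpha x))
}.

Definition commutator mu (x y : A) : A := mu x y - mu y x.

Fact commutator_is_bilinear mu :
  bilinear_for *:%R *:%R (commutator mu).
Proof.
split=> [y|x] k u v; rewrite /commutator linearPl linearPr /= scalerBr;
  by rewrite opprD addrACA.
Qed.

HB.instance Definition _ mu :=
  bilinear_isBilinear.Build K A A A *:%R *:%R (commutator mu)
    (commutator_is_bilinear mu).

Record hom_pre_malcev mu alpha : Prop := HomPreMalcev {
  hom_pre_malcev_mult : hom_multiplicative mu alpha;
  hom_pre_malcev_id : forall x y z t,
    mu (commutator mu (alpha y) (alpha z)) (alpha (mu x t))
    + mu (commutator mu (commutator mu x y) (alpha z)) (alpha (alpha t))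
    + mu (alpha (alpha y)) (mu (commutator mu x z) (alpha t))
    - mu (alpha (alpha x)) (mu (alpha y) (mu z t))
    + mu (alpha (alpha z)) (mu (alpha x) (mu y t)) = 0
}.

Record subalgebra mu alpha (S : {pred A}) : Prop := Subalgebra {
  subalgebra_submod : submod_closed S;
  subalgebra_mul : forall x y, x \in S -> y \in S -> mu x y \in S;
  subalgebra_twist : forall x, x \in S -> alpha x \in S
}.

End HomAlgebras.

Definition hom_morphism (K : fieldType) (A B : lmodType K)
    (muA : {bilinear A -> A -> A}) (alphaA : {linear A -> A})
    (muB : {bilinear B -> B -> B}) (alphaB : {linear B -> B})
    (f : {linear A -> B}) : Prop :=
  (forall x y, f (muA x y) = muB (f x) (f y))
  /\ (forall x, f (alphaA x) = alphaB (f x)).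

(* A linear map rho : A -> End(V) is encoded by the bilinear map
   (x, v) |-> rho(x)(v); identities in End(V) are stated pointwise. *)
Section Representations.
Variables (K : fieldType) (A V : lmodType K).
Variables (br : {bilinear A -> A -> A}) (alpha : {linear A -> A}).
Variables (rho : {bilinear A -> V -> V}) (beta : {linear V -> V}).

Record representation : Prop := Representation {
  representation_twist : forall x v, rho (alpha x) (beta v) = beta (rho x v);
  representation_id : forall x y z v,
    rho (br (br x y) (alpha z)) (beta (beta v))
    = rho (alpha (alpha x)) (rho (alpha y) (rho z v))
    - rho (alpha (alpha z)) (rho (alpha x) (rho y v))
    + rho (alpha (alpha y)) (rho (br z x) (beta v))
    - rho (alpha (br y z)) (rho (alpha x) (beta v))
}.

Record O_operator (T : {linear V -> A}) : Prop := OOperator {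
  O_operator_twist : forall a, alpha (T a) = T (beta a);
  O_operator_id : forall a b,
    br (T a) (T b) = T (rho (T a) b - rho (T b) a)
}.

Definition O_product (T : {linear V -> A}) (a b : V) : V := rho (T a) b.

Fact O_product_is_bilinear (T : {linear V -> A}) :
  bilinear_for *:%R *:%R (O_product T).
Proof.
by split=> [b|a] k u v; rewrite /O_product ?linearP ?linearPl ?linearPr.
Qed.

HB.instance Definition _ (T : {linear V -> A}) :=
  bilinear_isBilinear.Build K V V V *:%R *:%R (O_product T)
    (O_product_is_bilinear T).

End Representations.

Section Subspaces.
Variables (K : fieldType) (A : lmodType K).

Definition subspace (S : submodClosed A) : Type := {x : A | x \in S}.

HB.instance Definition _ (S : submodClosed A) :=
  SubChoice.copy (subspace S) {x : A | x \in S}.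
HB.instance Definition _ (S : submodClosed A) :=
  [SubChoice_isSubLmodule of subspace S by <:].

Variables (mu : {bilinear A -> A -> A}) (alpha : {linear A -> A}).
Variables (S : submodClosed A) (subS : subalgebra mu alpha S).

Definition sub_mul (u v : subspace S) : subspace S :=
  exist _ (mu (val u) (val v)) (subalgebra_mul subS (valP u) (valP v)).

Definition sub_twist (u : subspace S) : subspace S :=
  exist _ (alpha (val u)) (subalgebra_twist subS (valP u)).

Fact sub_mul_is_bilinear : bilinear_for *:%R *:%R sub_mul.
Proof.
by split=> w k u v; apply: val_inj; rewrite [RHS]linearP /= ?linearPl ?linearPr.
Qed.

HB.instance Definition _ :=
  bilinear_isBilinear.Build K (subspace S) (subspace S) (subspace S)
    *:%R *:%R sub_mul sub_mul_is_bilinear.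

Fact sub_twist_is_linear : linear sub_twist.
Proof. by move=> k u v; apply: val_inj; rewrite [RHS]linearP /= linearP. Qed.

HB.instance Definition _ :=
  GRing.isLinear.Build K (subspace S) (subspace S) *:%R sub_twist
    sub_twist_is_linear.

End Subspaces.

Section Image.
Variables (K : fieldType) (V A : lmodType K) (T : {linear V -> A}).

Definition image_pred : {pred A} := mem (range T).

Lemma image_predP x : reflect (exists a, T a = x) (x \in image_pred).
Proof.
apply: (iffP idP) => [|[a <-]].
  by rewrite inE => -[a _ <-]; exists a.
by rewrite inE; exists a.
Qed.

Fact image_pred_submod_closed : submod_closed image_pred.
Proof.
split; first by apply/image_predP; exists 0; rewrite linear0.
move=> k _ _ /image_predP[a <-] /image_predP[b <-].
by apply/image_predP; exists (k *: a + b); rewrite linearP.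
Qed.

HB.instance Definition _ :=
  GRing.isSubmodClosed.Build K A image_pred image_pred_submod_closed.

Fact mem_image_pred a : T a \in image_pred.
Proof. by apply/image_predP; exists a. Qed.

Definition onto_image (a : V) : subspace image_pred :=
  exist _ (T a) (mem_image_pred a).

Fact onto_image_is_linear : linear onto_image.
Proof. by move=> k u v; apply: val_inj; rewrite [RHS]linearP /= linearP. Qed.

HB.instance Definition _ :=
  GRing.isLinear.Build K V (subspace image_pred) *:%R onto_image
    onto_image_is_linear.

End Image.

(* Main.v *)
Require Import Defs.
From HB Require Import structures.
From mathcomp Require Import all_boot all_order all_algebra.
From mathcomp Require Import boolp classical_sets.

Set Implicit Arguments.
Unset Strict Implicit.
Unset Printing Implicit Defensive.

Import GRing.Theory.
Local Open Scope ring_scope.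

(* The representation identity at T a, T b, T c is the Hom-pre-Malcev identity
   for a . b = rho (T a) b, since T maps a . b - b . a to [T a, T b].  The
   commutator of a Hom-pre-Malcev product satisfies the Hom-Sagle identity,
   the sum of four cyclic instances of the Hom-pre-Malcev identity, and setting
   t = x there gives the Hom-Malcev identity.  Finally, for b in ker T one has
   T (rho (T a) b) = [T a, T b] = 0, so the product of V descends to T(V). *)

Lemma bilinear_anti (K : fieldType) (A B : lmodType K)
    (br : {bilinear A -> A -> B}) :
  (forall x, br x x = 0) -> forall x y, br x y = - br y x.
Proof.
move=> brxx x y; apply/eqP; rewrite -addr_eq0.
have := brxx (x + y).
by rewrite linearDl /= !linearDr /= !brxx addr0 add0r => ->.
Qed.

(** The hypothesis is Sagle's identity twisted by [alpha]. It is linear in each of four variables,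
    hence easier to check for a commutator than the defining identity, which is quadratic in [x]. *)
Lemma hom_malcev_sagle (K : fieldType) (A : lmodType K)
    (br : {bilinear A -> A -> A}) (alpha : {linear A -> A}) :
  hom_multiplicative br alpha -> (forall x, br x x = 0) ->
  (forall x y z t,
    br (br (alpha x) (alpha z)) (br (alpha y) (alpha t))
    = br (br (br x y) (alpha z)) (alpha (alpha t))
      + br (br (br y z) (alpha t)) (alpha (alpha x))
      + br (br (br z t) (alpha x)) (alpha (alpha y))
      + br (br (br t x) (alpha y)) (alpha (alpha z))) ->
  hom_malcev br alpha.
Proof.
move=> multA altA sagle; have antiA := bilinear_anti altA.
split=> // x y z; rewrite /hom_jacobian !linearDl /= multA.
(* Reversing two brackets brings the first Jacobian term to the left side of [sagle] at [t = x].
   There the fourth term contains [br x x], and the third cancels the last Jacobian term. *)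
rewrite (antiA (br (alpha x) (alpha y))) (antiA (alpha x) (alpha y)).
rewrite linearNr opprK /= sagle altA !linear0l addr0.
rewrite (antiA (alpha y) (br x z)) (antiA x z).
by rewrite !linearNl /= opprK addrAC addrK.
Qed.

Section CommutatorOfPreMalcev.
Variables (K : fieldType) (A : lmodType K).
Variables (mu : {bilinear A -> A -> A}) (alpha : {linear A -> A}).
Hypothesis preA : hom_pre_malcev mu alpha.

Local Notation "x ** y" := (mu x y) (at level 38, left associativity).
Local Notation br := (commutator mu).

Lemma commutator_anti x y : br x y = - br y x.
Proof. by rewrite /commutator opprB. Qed.

Lemma commutatorxx x : br x x = 0.
Proof. exact: subrr. Qed.

Lemma commutator_multiplicative : hom_multiplicative br alpha.
Proof.
by move=> x y; rewrite /commutator linearB !(hom_pre_malcev_mult preA).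
Qed.

(** The defining identity with its first two variables exchanged, solved for the kind of term that
    [commutator_pair] produces. *)
Lemma hom_pre_malcev_solved x y z t :
  br (alpha x) (alpha z) ** alpha (y ** t)
  = br (br x y) (alpha z) ** alpha (alpha t)
    - alpha (alpha x) ** (br y z ** alpha t)
    + alpha (alpha y) ** (alpha x ** (z ** t))
    - alpha (alpha z) ** (alpha y ** (x ** t)).
Proof.
have := hom_pre_malcev_id preA y x z t.
rewrite (commutator_anti y x) !linearNl /= => /eqP.
rewrite -!addrA addr_eq0 => /eqP ->.
by rewrite !opprD !opprK !addrA.
Qed.

(** Commutators that are left factors stay folded, as in [hom_pre_malcev_solved]; those that are
    right factors are expanded. *)
Lemma commutator_triple x y z t :
  br (br (br x y) (alpha z)) (alpha (alpha t))
  = br (br x y) (alpha z) ** alpha (alpha t)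
    - alpha (alpha t) ** (br x y ** alpha z)
    + alpha (alpha t) ** (alpha z ** (x ** y))
    - alpha (alpha t) ** (alpha z ** (y ** x)).
Proof.
rewrite {1}/commutator {3}/commutator linearBr /= opprB addrCA.
rewrite [in X in _ ** (alpha z ** X)]/commutator !linearBr /=.
by rewrite addrC addrA.
Qed.

(** Signs are absorbed into the left brackets, so that the four terms are the cyclic shifts of the
    first under [x -> y -> z -> t -> x]. *)
Lemma commutator_pair x y z t :
  br (br (alpha x) (alpha z)) (br (alpha y) (alpha t))
  = br (alpha x) (alpha z) ** alpha (y ** t)
    + br (alpha y) (alpha t) ** alpha (z ** x)
    + br (alpha z) (alpha x) ** alpha (t ** y)
    + br (alpha t) (alpha y) ** alpha (x ** z).
Proof.
rewrite (commutator_anti (alpha z) (alpha x)).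
rewrite (commutator_anti (alpha t) (alpha y)) !linearNl /=.
rewrite {1}/commutator -!commutator_multiplicative.
rewrite [in X in alpha (br x z) ** alpha X]/commutator.
rewrite [in X in alpha (br y t) ** alpha X]/commutator.
by rewrite !linearB /= opprK addrA [LHS](ACl (1 * 4 * 2 * 3))/=.
Qed.

Lemma commutator_sagle x y z t :
  br (br (alpha x) (alpha z)) (br (alpha y) (alpha t))
  = br (br (br x y) (alpha z)) (alpha (alpha t))
    + br (br (br y z) (alpha t)) (alpha (alpha x))
    + br (br (br z t) (alpha x)) (alpha (alpha y))
    + br (br (br t x) (alpha y)) (alpha (alpha z)).
Proof.
rewrite commutator_pair !hom_pre_malcev_solved !commutator_triple !addrA.
(* Each triple bracket on the right takes one term from each of the four cyclic instances on the
   left; positions drop by 3 modulo 16. *)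
by rewrite [LHS](ACl (1 * 14 * 11 * 8 * 5 * 2 * 15 * 12 *
                      9 * 6 * 3 * 16 * 13 * 10 * 7 * 4))/=.
Qed.

Lemma hom_malcev_commutator : hom_malcev br alpha.
Proof.
apply: hom_malcev_sagle commutator_sagle.
- exact: commutator_multiplicative.
- exact: commutatorxx.
Qed.

End CommutatorOfPreMalcev.

(** Identities pass to homomorphic images. This is meant for [onto_image T], the corestriction of
    [T] to its image. *)
Lemma hom_pre_malcev_surj (K : fieldType) (A B : lmodType K)
    (muA : {bilinear A -> A -> A}) (alphaA : {linear A -> A})
    (muB : {bilinear B -> B -> B}) (alphaB : {linear B -> B})
    (f : {linear A -> B}) :
  hom_morphism muA alphaA muB alphaB f -> (forall b, exists a, f a = b) ->
  hom_pre_malcev muA alphaA -> hom_pre_malcev muB alphaB.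
Proof.
move=> [fM fT] fS [multA idA].
have fC x y : f (commutator muA x y) = commutator muB (f x) (f y).
  by rewrite /commutator linearB !fM.
split=> [x y|x y z t].
  move: (fS x) (fS y) => [a <-] [b <-].
  by rewrite -!fM -!fT multA -fM.
move: (fS x) (fS y) (fS z) (fS t) => [a <-] [b <-] [c <-] [d <-].
by rewrite -!(fT, fM, fC) -!(linearD, linearB) idA linear0.
Qed.

Lemma hom_malcev_sub (K : fieldType) (A : lmodType K)
    (mu : {bilinear A -> A -> A}) (alpha : {linear A -> A})
    (S : submodClosed A) (subS : subalgebra mu alpha S) :
  hom_malcev mu alpha -> hom_malcev (sub_mul subS) (sub_twist subS).
Proof.
move=> [multA antiA idA].
split=> [x y|x y|x y z]; apply: val_inj; rewrite /= ?linearN /=.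
- exact: multA.
- exact: antiA.
- exact: idA.
Qed.

Section OOperator.
Variables (K : fieldType) (A V : lmodType K).
Variables (br : {bilinear A -> A -> A}) (alpha : {linear A -> A}).
Variables (rho : {bilinear A -> V -> V}) (beta : {linear V -> V}).
Variable T : {linear V -> A}.
Hypothesis antiA : forall x y, br x y = - br y x.
Hypothesis multA : hom_multiplicative br alpha.
Hypothesis repV : representation br alpha rho beta.
Hypothesis opT : O_operator br alpha rho beta T.

Lemma O_operator_commutator a b :
  T (commutator (O_product rho T) a b) = br (T a) (T b).
Proof. by rewrite (O_operator_id opT). Qed.

Lemma O_product_hom_pre_malcev : hom_pre_malcev (O_product rho T) beta.
Proof.
have multV : hom_multiplicative (O_product rho T) beta.
  move=> a b; rewrite /= /O_product.
  by rewrite -(O_operator_twist opT) (representation_twist repV).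
split=> // a b c d; rewrite multV /= /O_product !O_operator_commutator.
(* [representation_id] splits the second term into four, which cancel the other four terms in
   pairs. *)
rewrite -!(O_operator_twist opT) (representation_id repV) -multA.
rewrite (antiA (T c) (T a)) linearNl linearNr /=.
rewrite !addrA [LHS](ACl ((1 * 5) * (2 * 7) * (4 * 6) * (3 * 8)))/=.
by rewrite !subrr !addNr !addr0.
Qed.

Lemma image_subalgebra : subalgebra br alpha (image_pred T).
Proof.
split=> [|_ _ /image_predP[a <-] /image_predP[b <-]|_ /image_predP[a <-]].
- exact: image_pred_submod_closed.
- by rewrite -O_operator_commutator mem_image_pred.
- by rewrite (O_operator_twist opT) mem_image_pred.
Qed.

Lemma onto_image_surj (u : subspace (image_pred T)) :
  exists a, onto_image T a = u.
Proof. by have /image_predP[a Ta] := valP u; exists a; apply: val_inj. Qed.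

(** A section of [onto_image T] obtained by choice, with no claim of linearity. *)
Definition preimage (u : subspace (image_pred T)) : V :=
  projT1 (cid (onto_image_surj u)).

Lemma preimageK : cancel preimage (onto_image T).
Proof. by move=> u; rewrite /preimage; case: cid. Qed.

(** Only the right factor needs a preimage: [rho (T a)] depends on [a] through [T a] alone. *)
Definition image_product (u v : subspace (image_pred T)) :
  subspace (image_pred T) := onto_image T (rho (val u) (preimage v)).

Lemma O_operator_ker a b : T b = 0 -> T (rho (T a) b) = 0.
Proof.
move=> Tb0; have := O_operator_id opT a b.
by rewrite Tb0 linear0r linear0l subr0.
Qed.

Lemma image_productE a b :
  image_product (onto_image T a) (onto_image T b)
  = onto_image T (O_product rho T a b).
Proof.
(* The chosen preimage of [T b] differs from [b] by an element of the kernel of [T], so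
   [O_operator_ker] applies to the difference. *)
apply/val_inj/eqP; rewrite /= /O_product -subr_eq0 -linearB -linearBr /=.
apply/eqP/O_operator_ker; rewrite linearB.
by have /(congr1 val) /= -> := preimageK (onto_image T b); rewrite subrr.
Qed.

Lemma image_product_bilinear : bilinear_for *:%R *:%R image_product.
Proof.
split=> [v|u] k x y.
  by rewrite /image_product /= linearPl linearP.
(* Since [preimage] may fail to be linear, all arguments are written as images, which moves the
   claim to [O_product]. *)
rewrite -(preimageK u) -(preimageK x) -(preimageK y) -linearP !image_productE.
by rewrite linearPr linearP.
Qed.

End OOperator.

Theorem proposition3p2 (K : fieldType) (charK : [pchar K] =i pred0)
  (A : lmodType K) (br : {bilinear A -> A -> A}) (alpha : {linear A -> A})
  (malcevA : hom_malcev br alpha)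
  (V : lmodType K) (rho : {bilinear A -> V -> V}) (beta : {linear V -> V})
  (repV : representation br alpha rho beta)
  (T : {linear V -> A}) (opT : O_operator br alpha rho beta T) :
  (* (1) *)
  [/\ hom_pre_malcev (O_product rho T) beta,
      hom_malcev (commutator (O_product rho T)) beta
    & hom_morphism (commutator (O_product rho T)) beta br alpha T]
  /\
  (* (2) *)
  exists subT : subalgebra br alpha (image_pred T),
    hom_malcev (sub_mul subT) (sub_twist subT)
    /\
    exists mu : {bilinear subspace (image_pred T) ->
                          subspace (image_pred T) ->
                          subspace (image_pred T)},
      [/\ (forall a b, mu (onto_image T a) (onto_image T b)
                       = onto_image T (O_product rho T a b)),
          (forall mu' : subspace (image_pred T) -> subspace (image_pred T) ->
                        subspace (image_pred T),
             (forall a b, mu' (onto_image T a) (onto_image T b)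
                          = onto_image T (O_product rho T a b)) ->
             mu' =2 mu)
        & hom_pre_malcev mu (sub_twist subT)]
      /\
      (* (3) *)
      [/\ hom_malcev (commutator mu) (sub_twist subT),
          commutator mu =2 sub_mul subT
        & hom_morphism (O_product rho T) beta mu (sub_twist subT)
            (onto_image T)].
Proof.
have [multA antiA _] := malcevA.
have preV := O_product_hom_pre_malcev antiA multA repV opT.
split.
  split=> //; first exact: hom_malcev_commutator.
  split=> [a b|a]; first exact: (O_operator_commutator opT).
  by rewrite (O_operator_twist opT).
exists (image_subalgebra opT); split; first exact: hom_malcev_sub.
(* Bilinearity rests on the hypothesis [opT], so the structure is packed locally. *)
pose bilin := bilinear_isBilinear.Build K _ _ _ *:%R *:%R _
  (image_product_bilinear opT).
pose mu : {bilinear subspace (image_pred T) -> subspace (image_pred T) ->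
                    subspace (image_pred T)} :=
  HB.pack (image_product rho (T := T)) bilin.
have muE a b : mu (onto_image T a) (onto_image T b)
               = onto_image T (O_product rho T a b).
  exact: (image_productE opT).
exists mu.
have morT : hom_morphism (O_product rho T) beta mu
    (sub_twist (image_subalgebra opT)) (onto_image T).
  split=> [a b|a]; first by rewrite muE.
  by apply: val_inj; rewrite /= (O_operator_twist opT).
have preT : hom_pre_malcev mu (sub_twist (image_subalgebra opT)).
  exact: hom_pre_malcev_surj morT (@onto_image_surj _ _ _ T) preV.
split; split=> //.
(* Every element of [T(V)] is an image, so the values on images determine the product. *)
- move=> mu' mu'E u v.
  by rewrite -(preimageK u) -(preimageK v) mu'E muE.
- exact: hom_malcev_commutator.
- move=> u v; rewrite -(preimageK u) -(preimageK v) /commutator !muE.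
  apply: val_inj; rewrite -linearB /=.
  exact: (O_operator_commutator opT).
Qed.
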